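(* Let $G$ be a finite group, $\mathcal{H}$ a multiset of its subgroups, and $\varphi$ a weight function on $\mathcal{H}$. Assume that there exist $H_{0},H'_{0}\in\mathcal{H}$ and $i_{0}\in\{1,\ldots,m_{\mathcal{H}}(H_0)\}$ such that - $H'_{0}\subset H_{0}$; and - $\varphi(H_{0})_{i_{0}}\in(H_{0}:H'_{0})\,d_{\varphi}(H'_{0})\,\mathbb{Z}$. Denote by $\mathcal{H}'$ the multiset of subgroups of $G$ that satisfies, for every subgroup $H$ of $G$, $m_{\mathcal{H}'}(H)=m_{\mathcal{H}}(H_{0})-1$ if $H=H_{0}$ and $m_{\mathcal{H}'}(H)=m_{\mathcal{H}}(H)$ if $H\neq H_{0}$. Furthermore, define a weight function $\varphi'$ on $\mathcal{H}'$, which is normalized, by letting $\varphi'(H_{0})$ be the sequence obtained from $\varphi(H_{0})$ by deleting the $i_{0}$-th entry, and $\varphi'(H)=\varphi(H)$ if $H\neq H_{0}$. Then there exist isomorphisms of $G$-lattices $$I_{G/\mathcal{H}}^{(\varphi)}\cong I_{G/\mathcal{H}'}^{(\varphi')}\oplus\mathbb{Z}[G/H_{0}],\qquad J_{G/\mathcal{H}}^{(\varphi)}\cong J_{G/\mathcal{H}'}^{(\varphi')}\oplus\mathbb{Z}[G/H_{0}].$$ In particular, the $G$-lattice $J_{G/\mathcal{H}}^{(\varphi)}$ is quasi-permutation (resp. quasi-invertible) if and only if $J_{G/\mathcal{H}'}^{(\varphi')}$ is so.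
   Context: The symbol $\subset$ denotes inclusion, not necessarily proper. A $G$-lattice is a finitely generated free abelian group with a left action of $G$; $M^{\circ}=\mathrm{Hom}_{\mathbb{Z}}(M,\mathbb{Z})$ is the dual lattice, with $(gf)(x)=f(g^{-1}x)$. A $G$-lattice is permutation if it has a $\mathbb{Z}$-basis permuted by $G$. A $G$-lattice $M$ is quasi-permutation if there is an exact sequence of $G$-lattices $0\to M\to R\to F\to 0$ with $R,F$ permutation; it is quasi-invertible if it is a direct summand of a quasi-permutation $G$-lattice. For a multiset $\mathcal{H}$ of subgroups of $G$, $\mathcal{H}^{\mathrm{set}}$ is the underlying set and $m_{\mathcal{H}}(H)$ the multiplicity of $H$ (zero if $H\notin\mathcal{H}^{\mathrm{set}}$). A weight function $\varphi$ on $\mathcal{H}$ assigns to every $H\in\mathcal{H}^{\mathrm{set}}$ a non-decreasing sequence $\varphi(H)=(\varphi(H)_1\le\cdots\le\varphi(H)_{m})$ of positive integers of length $m=m_{\mathcal{H}}(H)$. Put $d_{\varphi}(H):=\gcd(\varphi(H)_1,\ldots,\varphi(H)_{m_{\mathcal{H}}(H)})$; $\varphi$ is normalized if $\gcd(d_\varphi(H)\mid H\in\mathcal{H}^{\mathrm{set}})=1$. Let $\varepsilon_{G/H}\colon\mathbb{Z}[G/H]\to\mathbb{Z}$ be the augmentation map (sum of coefficients). Then $$I_{G/\mathcal{H}}^{(\varphi)}:=\mathrm{Ker}\Big(\bigoplus_{H\in\mathcal{H}^{\mathrm{set}}}\mathbb{Z}[G/H]^{\oplus m_{\mathcal{H}}(H)}\longrightarrow\mathbb{Z}\Big),$$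 where the map is $\varphi(H)_i\cdot\varepsilon_{G/H}$ on the $i$-th copy of $\mathbb{Z}[G/H]$, and $J_{G/\mathcal{H}}^{(\varphi)}:=(I_{G/\mathcal{H}}^{(\varphi)})^{\circ}$.
   Formalization: If H'_0 = H_0 (where the second condition is vacuous and the claim fails), it is further assumed that the gcd of the remaining entries of φ(H_0) divides φ(H_0)_{i_0}; and ''φ' is normalized'' is claimed only when φ is normalized. *)

(* Defs.v *)
From HB Require Import structures.
From mathcomp Require Import all_boot all_order all_algebra all_fingroup.
From mathcomp Require Import finmap multiset.
From mathcomp Require Import mathcomp_extra boolp classical_sets functions.

Set Implicit Arguments.
Unset Strict Implicit.
Unset Printing Implicit Defensive.

Import GRing.Theory.
Local Open Scope ring_scope.

Lemma morphD_0 (U V : zmodType) (h : U -> V) : {morph h : x y / x + y} -> h 0 = 0.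
Proof. by move=> hD; apply: (addrI (h 0)); rewrite -hD !addr0. Qed.

Lemma morphD_Mz (U V : zmodType) (h : U -> V) :
  {morph h : x y / x + y} -> forall x (n : int), h (x *~ n) = h x *~ n.
Proof.
move=> hD x n; have h0 := morphD_0 hD.
have hn y k : h (y *+ k) = h y *+ k.
  by elim: k => [|k IH]; [rewrite !mulr0n | rewrite !mulrS hD IH].
have hN y : h (- y) = - h y by apply: (addrI (h y)); rewrite -hD !subrr.
case: n => n; first by rewrite -!pmulrn hn.
by rewrite NegzE !mulrNz -!pmulrn hN hn.
Qed.

Definition is_basis (M : zmodType) (I : finType) (b : I -> M) : Prop :=
  bijective (fun c : {ffun I -> int} => \sum_i b i *~ c i).

(* G is the group of all elements of gT. *)
Record glattice (gT : finGroupType) := GLattice {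
  gl_sort :> zmodType;
  gact : gT -> gl_sort -> gl_sort;
  gactD : forall g x y, gact g (x + y) = gact g x + gact g y;
  gact1 : forall x, gact 1%g x = x;
  gactM : forall g h x, gact (g * h)%g x = gact g (gact h x);
  gl_free : exists (I : finType) (b : I -> gl_sort), is_basis b }.

Section Maps.
Variable gT : finGroupType.
Implicit Types M N R F : glattice gT.

Definition equivariant M N (f : M -> N) : Prop :=
  forall g x, f (gact g x) = gact g (f x).

Definition giso M N : Prop :=
  exists2 f : {additive M -> N}, equivariant f & bijective f.

Definition is_permutation M : Prop :=
  exists (I : finType) (b : I -> M),
    is_basis b /\ forall g i, exists j, gact g (b i) = b j.

Definition short_exact M R F (i : M -> R) (p : R -> F) : Prop :=
  [/\ injective i,
      forall y, p y = 0 <-> exists x, y = i x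
    & forall z, exists y, p y = z].

Definition quasi_permutation M : Prop :=
  exists R F : glattice gT,
    [/\ is_permutation R, is_permutation F
      & exists (i : {additive M -> R}) (p : {additive R -> F}),
          [/\ equivariant i, equivariant p & short_exact i p]].

End Maps.

Section DirectSum.
Variable gT : finGroupType.

Section Binary.
Variables M N : glattice gT.

Definition gsum_act (g : gT) (x : M * N) : M * N := (gact g x.1, gact g x.2).

Lemma gsum_actD g x y : gsum_act g (x + y) = gsum_act g x + gsum_act g y.
Proof. by rewrite /gsum_act !gactD. Qed.

Lemma gsum_act1 x : gsum_act 1%g x = x.
Proof. by case: x => x y; rewrite /gsum_act !gact1. Qed.

Lemma gsum_actM g h x : gsum_act (g * h)%g x = gsum_act g (gsum_act h x).
Proof. by rewrite /gsum_act !gactM. Qed.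

Lemma gsum_free : exists (I : finType) (b : I -> M * N), is_basis b.
Proof.
have [I [b [bi bK Kb]]] := gl_free M; have [J [c [ci cK Kc]]] := gl_free N.
pose e (k : I + J) : M * N :=
  match k with inl i => (b i, 0) | inr j => (0, c j) end.
exists (I + J)%type, e.
have E (f : {ffun I + J -> int}) : \sum_k e k *~ f k =
   (\sum_i b i *~ [ffun i => f (inl i)] i, \sum_j c j *~ [ffun j => f (inr j)] j).
  rewrite big_sumType /=.
  rewrite [X in _ = X]surjective_pairing /=.
  apply: injective_projections => /=.
    rewrite !raddf_sum /= [X in _ + X]big1 ?addr0 => [|j _].
      by apply: eq_bigr => i _; rewrite (raddfMz (@fst M N)) ffunE.
    by rewrite (raddfMz (@fst M N)) /= mul0rz.
  rewrite !raddf_sum /= [X in X + _]big1 ?add0r => [|j _].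
    by apply: eq_bigr => i _; rewrite (raddfMz (@snd M N)) ffunE.
  by rewrite (raddfMz (@snd M N)) /= mul0rz.
exists (fun x => [ffun k => match k with inl i => bi x.1 i | inr j => ci x.2 j end]).
  move=> f; rewrite E /= bK cK; apply/ffunP => -[i|j]; by rewrite !ffunE.
move=> [x y]; rewrite E /=; congr pair.
  by rewrite -[RHS]Kb; apply: eq_bigr => i _; rewrite !ffunE.
by rewrite -[RHS]Kc; apply: eq_bigr => i _; rewrite !ffunE.
Qed.

Definition gsum : glattice gT :=
  GLattice gsum_actD gsum_act1 gsum_actM gsum_free.

End Binary.

Section Family.
Variables (I : finType) (M : I -> glattice gT).

Definition dsum : Type := forall i, M i.
HB.instance Definition _ := Choice.copy dsum (forall i, M i).

Definition dsum_add (x y : dsum) : dsum := fun i => x i + y i.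
Definition dsum_zero : dsum := fun i => 0.
Definition dsum_opp (x : dsum) : dsum := fun i => - x i.

Lemma dsum_addA : associative dsum_add.
Proof. by move=> x y z; apply: functional_extensionality_dep => i; exact: addrA. Qed.
Lemma dsum_addC : commutative dsum_add.
Proof. by move=> x y; apply: functional_extensionality_dep => i; exact: addrC. Qed.
Lemma dsum_add0 : left_id dsum_zero dsum_add.
Proof. by move=> x; apply: functional_extensionality_dep => i; exact: add0r. Qed.
Lemma dsum_addN : left_inverse dsum_zero dsum_opp dsum_add.
Proof. by move=> x; apply: functional_extensionality_dep => i; exact: addNr. Qed.

HB.instance Definition _ :=
  GRing.isZmodule.Build dsum dsum_addA dsum_addC dsum_add0 dsum_addN.

Definition dsum_act (g : gT) (x : dsum) : dsum := fun i => gact g (x i).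

Lemma dsum_actD g x y : dsum_act g (x + y) = dsum_act g x + dsum_act g y.
Proof. by apply: functional_extensionality_dep => i; exact: gactD. Qed.

Lemma dsum_act1 x : dsum_act 1%g x = x.
Proof. by apply: functional_extensionality_dep => i; exact: gact1. Qed.

Lemma dsum_actM g h x : dsum_act (g * h)%g x = dsum_act g (dsum_act h x).
Proof. by apply: functional_extensionality_dep => i; exact: gactM. Qed.

Lemma dsum_free : exists (J : finType) (b : J -> dsum), is_basis b.
Proof.
have [J hJ] := choice (fun i => gl_free (M i)).
pose b i := projT1 (cid (hJ i)).
have hb i : is_basis (b i) := projT2 (cid (hJ i)).
have hc i : exists c : M i -> {ffun J i -> int},
    cancel (fun c : {ffun J i -> int} => \sum_j b i j *~ c j) c /\
    cancel c (fun c : {ffun J i -> int} => \sum_j b i j *~ c j).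
  by have [c cK Kc] := hb i; exists c.
pose c i := projT1 (cid (hc i)).
have cK i : cancel (fun c : {ffun J i -> int} => \sum_j b i j *~ c j) (c i) :=
  (projT2 (cid (hc i))).1.
have Kc i : cancel (c i) (fun c : {ffun J i -> int} => \sum_j b i j *~ c j) :=
  (projT2 (cid (hc i))).2.
pose e (k : {i & J i}) : dsum := @eqtype.dfwith I M (fun i => 0) (tag k) (b (tag k) (tagged k)).
exists {i : I & J i}, e.
have ev i : additive (fun x : dsum => x i) by [].
have evS (i : I) (T : Type) (s : seq T) P (F : T -> dsum) :
    (\sum_(k <- s | P k) F k) i = \sum_(k <- s | P k) F k i.
  by apply: (big_morph (fun x : dsum => x i)).
have evZ (i : I) (x : dsum) (n : int) : (x *~ n) i = x i *~ n.
  exact: (@morphD_Mz dsum (M i) (fun x => x i)).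
have E (f : {ffun {i : I & J i} -> int}) i :
   (\sum_k e k *~ f k) i = \sum_j b i j *~ [ffun j => f (Tagged J j)] j.
  rewrite evS (eq_bigr (fun k => e (Tagged J (tagged k)) i *~ f (Tagged J (tagged k)))).
    2: by move=> [k j] _; rewrite evZ.
  rewrite -(@sig_big_dep _ _ _ _ _ xpredT (fun=> xpredT)
     (fun i' j => e (Tagged J j) i *~ f (Tagged J j))) /=.
  rewrite (bigD1 i) //= [X in _ + X]big1 ?addr0 => [|k ki].
    by apply: eq_bigr => j _; rewrite ffunE /e /= dfwith_in.
  by apply: big1 => j _; rewrite /e /= dfwith_out // mul0rz.
exists (fun x : dsum => [ffun k : {i : I & J i} => c (tag k) (x (tag k)) (tagged k)]).
  by move=> f; apply/ffunP => -[i j]; rewrite ffunE /= E cK ffunE.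
move=> x; apply: functional_extensionality_dep => i; rewrite E -[RHS]Kc.
by apply: eq_bigr => j _; rewrite !ffunE.
Qed.

Definition gdsum : glattice gT :=
  GLattice dsum_actD dsum_act1 dsum_actM dsum_free.

End Family.
End DirectSum.

Definition quasi_invertible (gT : finGroupType) (M : glattice gT) : Prop :=
  exists Q N : glattice gT, quasi_permutation Q /\ giso Q (gsum M N).

Section Dual.
Variables (gT : finGroupType) (M : glattice gT).

Definition dual_pred : {pred (M -> int)} :=
  fun f => `[< forall x y, f (x + y) = f x + f y >].

Lemma dual_zmod_closed : zmod_closed dual_pred.
Proof.
split; first by apply/asboolP => x y; rewrite /= addr0.
move=> f g /asboolP fD /asboolP gD; apply/asboolP => x y.
have E z : (f - g) z = f z - g z by [].
by rewrite !E fD gD opprD addrACA.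
Qed.
HB.instance Definition _ :=
  GRing.isZmodClosed.Build (M -> int) dual_pred dual_zmod_closed.

Record dual := Dual { dual_fun :> M -> int; _ : dual_fun \in dual_pred }.
HB.instance Definition _ := [isSub for dual_fun].
HB.instance Definition _ := [Choice of dual by <:].
HB.instance Definition _ := [SubChoice_isSubZmodule of dual by <:].

Lemma dualD (f : dual) x y : f (x + y) = f x + f y.
Proof. by case: f => f /= /asboolP. Qed.

Lemma dual_eqP (f h : dual) : (forall x, f x = h x) -> f = h.
Proof. by move=> E; apply: val_inj; apply: functional_extensionality_dep. Qed.

Lemma dual_act_subproof g (f : dual) :
  (fun x => f (gact g^-1%g x)) \in dual_pred.
Proof. by apply/asboolP => x y; rewrite gactD dualD. Qed.

Definition dual_act g (f : dual) : dual := Dual (dual_act_subproof g f).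

Lemma dual_actD g f h : dual_act g (f + h) = dual_act g f + dual_act g h.
Proof. exact: dual_eqP. Qed.

Lemma dual_act1 f : dual_act 1%g f = f.
Proof. by apply: dual_eqP => x /=; rewrite invg1 gact1. Qed.

Lemma dual_actM g h f : dual_act (g * h)%g f = dual_act g (dual_act h f).
Proof. by apply: dual_eqP => x /=; rewrite invMg gactM. Qed.

Lemma dual_free : exists (I : finType) (b : I -> dual), is_basis b.
Proof.
have [I [b [c cK Kc]]] := gl_free M.
have cD x y : c (x + y) = c x + c y.
  apply: (can_inj cK); rewrite Kc -{1}(Kc x) -{1}(Kc y) -big_split /=.
  by apply: eq_bigr => i _; rewrite ffunE mulrzDr.
have ci i : (fun x => c x i) \in dual_pred.
  by apply/asboolP => x y; rewrite cD ffunE.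
have cb i j : c (b i) j = (i == j)%:R.
  have -> : b i = \sum_k b k *~ [ffun k => (i == k)%:R : int] k.
    rewrite (bigD1 i) //= ffunE eqxx mulr1z big1 ?addr0 // => k ki.
    by rewrite ffunE eq_sym (negbTE ki) mulr0z.
  by rewrite cK ffunE.
have evS x (a : {ffun I -> int}) (F : I -> dual) :
    (\sum_i F i *~ a i) x = \sum_i F i x * a i.
  have evD : {morph (fun f : dual => f x) : f h / f + h} by [].
  rewrite (big_morph _ evD (morphD_0 evD)); apply: eq_bigr => i _.
  by rewrite (morphD_Mz evD) mulrzz.
exists I, (fun i => Dual (ci i)); exists (fun f : dual => [ffun i => f (b i)]).
  move=> a; apply/ffunP => j; rewrite ffunE evS /= (bigD1 j) //= cb eqxx mul1r.
  by rewrite big1 ?addr0 // => i ij; rewrite cb eq_sym (negbTE ij) mul0r.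
move=> f; apply: dual_eqP => x; rewrite evS /= -[in RHS](Kc x).
have fD : {morph (f : M -> int) : y z / y + z} by exact: dualD.
rewrite (big_morph _ fD (morphD_0 fD)); apply: eq_bigr => i _.
by rewrite ffunE (morphD_Mz fD) mulrzz mulrC.
Qed.

Definition gdual : glattice gT :=
  GLattice dual_actD dual_act1 dual_actM dual_free.

End Dual.

(* G acts trivially on Z, so f_inv says that f is equivariant. *)

Section Kernel.
Variables (gT : finGroupType) (M : glattice gT) (f : {additive M -> int}).
Hypothesis f_inv : forall g x, f (gact g x) = f x.

Definition ker_pred : {pred M} := fun x => f x == 0.

Lemma ker_zmod_closed : zmod_closed ker_pred.
Proof.
split; first by rewrite unfold_in raddf0.
by move=> x y; rewrite !unfold_in raddfB => /eqP -> /eqP ->; rewrite subrr.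
Qed.
HB.instance Definition _ := GRing.isZmodClosed.Build M ker_pred ker_zmod_closed.

Record ker := Ker { ker_val :> M; _ : ker_val \in ker_pred }.
HB.instance Definition _ := [isSub for ker_val].
HB.instance Definition _ := [Choice of ker by <:].
HB.instance Definition _ := [SubChoice_isSubZmodule of ker by <:].

Lemma ker_act_subproof g (x : ker) : gact g (ker_val x) \in ker_pred.
Proof. by case: x => x /= /eqP fx; rewrite unfold_in f_inv fx. Qed.

Definition ker_act g (x : ker) : ker := Ker (ker_act_subproof g x).

Lemma ker_actD g x y : ker_act g (x + y) = ker_act g x + ker_act g y.
Proof. by apply: val_inj; exact: gactD. Qed.

Lemma ker_act1 x : ker_act 1%g x = x.
Proof. by apply: val_inj; exact: gact1. Qed.

Lemma ker_actM g h x : ker_act (g * h)%g x = ker_act g (ker_act h x).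
Proof. by apply: val_inj; exact: gactM. Qed.

Lemma ker_free : exists (I : finType) (b : I -> ker), is_basis b.
Proof.
have [I0 [b0 [c0 c0K Kc0]]] := gl_free M.
pose n := #|I0|.
pose toM (v : 'rV[int]_n) : M := \sum_k b0 (enum_val k) *~ v 0 k.
pose ofM (x : M) : 'rV[int]_n := \row_k c0 x (enum_val k).
have ofMK : cancel ofM toM.
  move=> x; rewrite -[RHS]Kc0 /toM (reindex (@enum_val _ (mem I0))) /=.
    by apply: eq_bigr => k _; rewrite mxE.
  by apply: onW_bij; exact: enum_val_bij.
have toMK : cancel toM ofM.
  move=> v; apply/rowP => k; rewrite mxE.
  have -> : toM v = \sum_i b0 i *~ [ffun i => v 0 (enum_rank i)] i.
    rewrite [RHS](reindex (@enum_val _ (mem I0))) /=.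
      by apply: eq_bigr => j _; rewrite ffunE enum_valK.
    by apply: onW_bij; exact: enum_val_bij.
  by rewrite c0K ffunE enum_valK.
pose w : 'cV[int]_n := \col_k f (b0 (enum_val k)).
have fE v : f (toM v) = (v *m w) 0 0.
  rewrite /toM raddf_sum mxE; apply: eq_bigr => k _.
  by rewrite raddfMz mxE mulrzz mulrC.
have [L uL [R uR [d _ wE]]] := int_Smith_normal_form w.
pose e (k : 'I_n) : int := d`_k *+ (k == 0%N :> nat).
pose D : 'cV[int]_n := \matrix_(i, j) (d`_i *+ (i == j :> nat)).
have kerE v : (f (toM v) == 0) = [forall k, (e k != 0) ==> ((v *m L) 0 k == 0)].
  rewrite fE wE -/D !mulmxA.
  have -> : ((v *m L *m D *m R) 0 0 == 0) = ((v *m L *m D) 0 0 == 0).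
    rewrite [_ *m R]mx11_scalar [X in (X %:M) 0 0]mxE big_ord1 mxE eqxx mulr1n mulf_eq0.
    case R0: (R 0 0 == 0); last by rewrite orbF.
    by move: uR; rewrite unitmxE [R]mx11_scalar (eqP R0) det_scalar1 unitr0.
  have -> : (v *m L *m D) 0 0 = \sum_k (v *m L) 0 k * e k.
    by rewrite mxE; apply: eq_bigr => k _; rewrite [D _ _]mxE.
  apply/eqP/forallP => [s0 k|h].
    apply/implyP => ek; have k0 : k == 0%N :> nat.
      by move: ek; rewrite /e; case: (_ == 0%N) => //; rewrite mulr0n eqxx.
    move: s0; rewrite (bigD1 k) //= big1 ?addr0 => [/eqP|j jk].
      by rewrite mulf_eq0 (negbTE ek) orbF.
    rewrite /e; case: eqP => [j0|_]; last by rewrite mulr0n mulr0.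
    by case/eqP: jk; apply: val_inj; rewrite /= j0 (eqP k0).
  rewrite big1 // => k _; have /implyP := h k.
  by case: eqP => [-> _|_ /(_ isT)/eqP ->]; rewrite ?mulr0 ?mul0r.
pose I := {k : 'I_n | e k == 0}.
pose P (a : {ffun I -> int}) : 'rV[int]_n :=
  (\row_k (if insub k is Some i then a i else 0)) *m invmx L.
have bP (i : I) : toM (row (val i) (invmx L)) \in ker_pred.
  rewrite unfold_in kerE; apply/forallP => k; apply/implyP => ek.
  rewrite -row_mul mulVmx // !mxE; case: (eqVneq (val i) k) => // ik.
  by move: ek; rewrite -ik (valP i).
pose b i := Ker (bP i).
exists I, b.
have vS (a : {ffun I -> int}) : ker_val (\sum_i b i *~ a i) = toM (P a).
  have toMD : {morph toM : u v / u + v}.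
    move=> u v; rewrite /toM -big_split /=; apply: eq_bigr => k _.
    by rewrite mxE mulrzDr.
  have -> : P a = \sum_i a i *: row (val i) (invmx L).
    rewrite /P; apply/rowP => j; rewrite mxE summxE.
    rewrite (bigID (fun k => e k == 0)) /= [X in _ + X]big1 ?addr0; last first.
      by move=> k ek; rewrite mxE insubN // mul0r.
    rewrite (reindex_omap (val : I -> 'I_n) insub) /=; last first.
      by move=> k ek; rewrite insubT.
    apply: eq_big => [i|i _]; first by rewrite valK eqxx (valP i).
    by rewrite !mxE valK.
  rewrite (big_morph toM toMD (morphD_0 toMD)).
  rewrite (big_morph ker_val (id1 := 0) (op1 := +%R)) //.
  apply: eq_bigr => i _.
  have vM (x : ker) m : ker_val (x *~ m) = ker_val x *~ m.
    exact: (raddfMz (val : {additive ker -> M})).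
  by rewrite vM -[a i in RHS]intz scaler_int (morphD_Mz toMD).
exists (fun x : ker => [ffun i : I => (ofM (ker_val x) *m L) 0 (val i) : int]).
  move=> a; apply/ffunP => i; rewrite ffunE vS toMK mulmxKV // mxE.
  by rewrite valK.
move=> x; apply: val_inj; rewrite /= vS -[RHS]ofMK; congr toM.
rewrite -[RHS](mulmxK uL); congr (_ *m _); apply/rowP => k; rewrite mxE.
case: insubP => [i _ ik|ek]; first by rewrite ffunE ik.
have: ker_val x \in ker_pred by case: x.
rewrite unfold_in -[ker_val x]ofMK kerE => /forallP /(_ k).
by rewrite ek => /eqP; rewrite ofMK.
Qed.

Definition gker : glattice gT :=
  GLattice ker_actD ker_act1 ker_actM ker_free.

End Kernel.

(* In Z[G/H], the formal sum of the a_c c over the left cosets c of H is encoded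
   by the function c |-> a_c, so that (g a)_c = a_(g^-1 c). *)

Section CosetLattice.
Variables (gT : finGroupType) (H : {group gT}).

Definition lcoset_of : finType := {c : {set gT} | c \in lcosets H [set: gT]}.

Lemma lcoset_act_subproof g (c : lcoset_of) :
  (g *: val c)%g \in lcosets H [set: gT].
Proof.
case: c => c /= /lcosetsP[x _ ->].
by apply/lcosetsP; exists (g * x)%g; rewrite ?inE // mulgA mulg_set1.
Qed.

Definition lcoset_act g (c : lcoset_of) : lcoset_of :=
  Sub (g *: val c)%g (lcoset_act_subproof g c).

Lemma lcoset_act1 c : lcoset_act 1%g c = c.
Proof. by apply: val_inj; rewrite /= mul1g. Qed.

Lemma lcoset_actM g h c :
  lcoset_act (g * h)%g c = lcoset_act g (lcoset_act h c).
Proof. by apply: val_inj; rewrite /= mulgA mulg_set1. Qed.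

Definition zcoset_act g (a : {ffun lcoset_of -> int}) :
    {ffun lcoset_of -> int} :=
  [ffun c => a (lcoset_act g^-1%g c)].

Lemma zcoset_actD g a b : zcoset_act g (a + b) = zcoset_act g a + zcoset_act g b.
Proof. by apply/ffunP => c; rewrite !ffunE. Qed.

Lemma zcoset_act1 a : zcoset_act 1%g a = a.
Proof. by apply/ffunP => c; rewrite ffunE invg1 lcoset_act1. Qed.

Lemma zcoset_actM g h a :
  zcoset_act (g * h)%g a = zcoset_act g (zcoset_act h a).
Proof. by apply/ffunP => c; rewrite !ffunE invMg lcoset_actM. Qed.

Lemma zcoset_free :
  exists (I : finType) (b : I -> {ffun lcoset_of -> int}), is_basis b.
Proof.
exists lcoset_of, (fun c => [ffun c' => (c == c')%:R]).
exists id => a; apply/ffunP => c; rewrite sum_ffunE (bigD1 c) //= big1 ?addr0.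
- by rewrite ffunMzE ffunE eqxx intz.
- by move=> i ic; rewrite ffunMzE ffunE (negbTE ic) mul0rz.
- by rewrite ffunMzE ffunE eqxx intz.
- by move=> i ic; rewrite ffunMzE ffunE (negbTE ic) mul0rz.
Qed.

Definition zcoset : glattice gT :=
  GLattice zcoset_actD zcoset_act1 zcoset_actM zcoset_free.

Definition aug (a : zcoset) : int := \sum_c (a : {ffun lcoset_of -> int}) c.

Lemma augD a b : aug (a + b) = aug a + aug b.
Proof. by rewrite /aug -big_split; apply: eq_bigr => c _; rewrite ffunE. Qed.

Lemma aug_act g a : aug (gact g a) = aug a.
Proof.
rewrite /aug [RHS](reindex_inj (h := lcoset_act g^-1%g)) /=.
  by apply: eq_bigr => c _; rewrite ffunE.
by apply: (can_inj (g := lcoset_act g)) => c; rewrite -lcoset_actM mulgV lcoset_act1.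
Qed.

End CosetLattice.

Local Open Scope mset_scope.

(* Sequences are indexed from 0; phi H is the empty sequence when H does not
   occur in calH *)
Record weight (gT : finGroupType) (calH : {mset {group gT}}) := Weight {
  wt :> forall H : {group gT}, (calH H).-tuple nat;
  wt_sorted : forall H : {group gT}, sorted leq (wt H);
  wt_gt0 : forall (H : {group gT}) (i : 'I_(calH H)), (0 < tnth (wt H) i)%N }.

Section Weights.
Variables (gT : finGroupType) (calH : {mset {group gT}}) (phi : weight calH).

Definition wgcd (H : {group gT}) : nat := \big[gcdn/0%N]_(n <- phi H) n.

Definition normalized : Prop :=
  \big[gcdn/0%N]_(H : {group gT} | H \in calH) wgcd H = 1%N.

(* The summands Z[G/H] of the source of the weighted augmentation: subgroups of
   multiplicity 0 contribute no index. *)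
Definition copies : finType := {H : {group gT} & 'I_(calH H)}.

Definition iamb : glattice gT := gdsum (fun k : copies => zcoset (tag k)).

Definition waug (x : iamb) : int :=
  \sum_(k : copies) (tnth (phi (tag k)) (tagged k))%:Z * aug (x k).

Lemma waug_is_additive : {morph waug : x y / x + y}.
Proof.
move=> x y; rewrite /waug -big_split; apply: eq_bigr => k _ /=.
by rewrite -mulrDr -augD.
Qed.

Lemma waug_is_zmod_morphism : zmod_morphism waug.
Proof.
move=> x y; apply: (addIr (waug y)).
by rewrite -waug_is_additive !subrK.
Qed.
HB.instance Definition _ :=
  GRing.isZmodMorphism.Build iamb int waug waug_is_zmod_morphism.

Lemma waug_act g x : waug (gact g x) = waug x.
Proof. by apply: eq_bigr => k _; rewrite aug_act. Qed.

Definition ilat : glattice gT := gker waug_act.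
Definition jlat : glattice gT := gdual ilat.

End Weights.

Section Deletion.
Variables (gT : finGroupType) (calH : {mset {group gT}}) (phi : weight calH).
Variables (H0 : {group gT}) (i : 'I_(calH H0)).

Definition wdel_seq (H : {group gT}) : seq nat :=
  if H == H0 then take i (phi H) ++ drop i.+1 (phi H) else phi H.

Lemma wdel_size H : size (wdel_seq H) == (calH `\ H0) H.
Proof.
rewrite /wdel_seq msetB1E; case: (eqVneq H H0) => [->|_]; last by rewrite size_tuple subn0.
have iH := ltn_ord i.
rewrite size_cat size_take size_drop size_tuple iH subn1.
by apply/eqP; apply: succn_inj; rewrite -addSn subnKC // (ltn_predK iH).
Qed.

Lemma wdel_subseq H : subseq (wdel_seq H) (phi H).
Proof.
rewrite /wdel_seq; case: eqP => // _.
rewrite -{3}(cat_take_drop i (phi H)) cat_subseq //.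
by rewrite -addn1 addnC -drop_drop drop_subseq.
Qed.

Definition wdel_tuple H : ((calH `\ H0) H).-tuple nat := Tuple (wdel_size H).

Lemma wdel_sorted H : sorted leq (wdel_tuple H).
Proof. by apply: (subseq_sorted leq_trans (wdel_subseq H)); exact: wt_sorted. Qed.

Lemma wdel_gt0 (H : {group gT}) (j : 'I_((calH `\ H0) H)) :
  (0 < tnth (wdel_tuple H) j)%N.
Proof.
have /tnthP[k ->] : tnth (wdel_tuple H) j \in phi H.
  by apply: (mem_subseq (wdel_subseq H)); exact: mem_tnth.
exact: wt_gt0.
Qed.

Definition wdel : weight (calH `\ H0) := Weight wdel_sorted wdel_gt0.

End Deletion.

(* Main.v *)
Require Import Defs.
From HB Require Import structures.
From mathcomp Require Import all_boot all_order all_algebra all_fingroup.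
From mathcomp Require Import finmap multiset.
From mathcomp Require Import boolp.
From mathcomp Require Import zify ring.

Set Implicit Arguments.
Unset Strict Implicit.
Unset Printing Implicit Defensive.

Import GRing.Theory Num.Theory Defs.

(** Write w for the entry of phi at (H0, i0), the one that is deleted.  The
    lattice I is the kernel of the weighted augmentation on a direct sum that
    contains the copy (H0, i0) of Z[G/H0]; the other copies form the source of
    the weighted augmentation attached to phi'.  Suppose that there is an
    equivariant map s from Z[G/H0] to these other copies along which the
    augmentation for phi' pulls back to w times the augmentation of Z[G/H0].
    Then the shear (x', z) |-> (x' + s z, z) turns the augmentation for phi into
    the augmentation for phi' composed with the first projection, so its kernel
    becomes the kernel for phi' plus a full copy of Z[G/H0]
    ([giso_ilat_wdel]).

    To build s, use the transfer Z[G/H0] -> Z[G/H0'], which multiplies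
    augmentations by (H0 : H0') ([transfer]).  Since w is a multiple of
    (H0 : H0') times the gcd of the weights of phi' at H0', a Bezout relation
    between these weights says by how much to scale the transfer into each copy of
    Z[G/H0'] ([lift_augmentation]).  The isomorphism for J follows by duality,
    because Z[G/H0] is self-dual.

    It remains to see that a summand P = Z[G/H0] does not affect
    quasi-permutation; only cancelling P needs an idea.  Given an exact sequence
    0 -> M + P -> R -> F -> 0 with R and F permutation, the projection M + P -> P
    extends to an equivariant map e : R -> P, and then 0 -> M -> R -> F + P -> 0,
    with second map (p, e), is exact ([quasi_permutation_cancel]).  The
    extension e exists because Ext^1(F, Z[G/H]) = 0 for F permutation, which
    comes down to the vanishing of H^1 of a finite group with coefficients Z.
    Here this is made explicit: by Frobenius reciprocity a map to Z[G/H] is an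
    H-invariant functional, and such a functional is extended by averaging over
    H and discarding the remainders modulo |H| ([extend_functional]). *)

Local Open Scope mset_scope.
Local Open Scope nat_scope.
Local Open Scope ring_scope.

(** * Additive maps and bases *)

Lemma additive_of (U V : zmodType) (f : U -> V) :
  {morph f : x y / x + y} -> exists F : {additive U -> V}, F =1 f.
Proof.
move=> fD.
have fB : zmod_morphism f.
  by move=> x y; apply: (addIr (f y)); rewrite -fD !subrK.
by exists (HB.pack_for {additive U -> V} f (GRing.isZmodMorphism.Build U V f fB)).
Qed.

Lemma inj_surj_bijective (A B : Type) (f : A -> B) :
  injective f -> (forall y, exists x, f x = y) -> bijective f.
Proof.
move=> f_inj /choice[g gK]; exists g => // x.
by apply: f_inj; rewrite gK.
Qed.

Lemma basis_span (M : zmodType) (I : finType) (b : I -> M) :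
  is_basis b -> forall x, exists c : I -> int, x = \sum_i b i *~ c i.
Proof. by case=> g _ gK x; exists (g x); rewrite gK. Qed.

Lemma basis_ext (M N : zmodType) (I : finType) (b : I -> M)
    (f h : {additive M -> N}) :
  is_basis b -> (forall i, f (b i) = h (b i)) -> f =1 h.
Proof.
move=> b_basis fh x; have [c ->] := basis_span b_basis x.
by rewrite !raddf_sum; apply: eq_bigr => i _; rewrite !raddfMz /= fh.
Qed.

Lemma basis_extend (M N : zmodType) (I : finType) (b : I -> M) (v : I -> N) :
  is_basis b -> exists f : {additive M -> N}, forall i, f (b i) = v i.
Proof.
move=> [c cK Kc].
have cD x y : c (x + y) = c x + c y.
  apply: (can_inj cK); rewrite Kc -{1}(Kc x) -{1}(Kc y) -big_split /=.
  by apply: eq_bigr => i _; rewrite ffunE mulrzDr.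
have fD : {morph (fun x => \sum_i v i *~ c x i) : x y / x + y}.
  move=> x y; rewrite -big_split /=; apply: eq_bigr => i _.
  by rewrite cD ffunE mulrzDr.
have [f fE] := additive_of fD; exists f => i; rewrite fE.
have -> : c (b i) = [ffun j => (i == j)%:R : int].
  apply: (can_inj cK); rewrite Kc (bigD1 i) //= ffunE eqxx mulr1z.
  by rewrite big1 ?addr0 // => j ji; rewrite ffunE eq_sym (negbTE ji) mulr0z.
rewrite (bigD1 i) //= ffunE eqxx mulr1z big1 ?addr0 // => j ji.
by rewrite ffunE eq_sym (negbTE ji) mulr0z.
Qed.

Lemma is_basis_sum (M N : zmodType) (I J : finType) (b : I -> M) (c : J -> N) :
  is_basis b -> is_basis c ->
  is_basis (fun k : I + J =>
    match k with inl i => (b i, 0) | inr j => (0, c j) end : M * N).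
Proof.
move=> [bi bK Kb] [ci cK Kc].
set e := (fun k : I + J => _).
have E (f : {ffun I + J -> int}) : \sum_k e k *~ f k =
    (\sum_i b i *~ [ffun i => f (inl i)] i,
     \sum_j c j *~ [ffun j => f (inr j)] j).
  rewrite big_sumType /=; apply: injective_projections.
    rewrite raddfD /= !raddf_sum /= [X in _ + X]big1 ?addr0 => [|j _].
      by apply: eq_bigr => i _; rewrite (raddfMz (@fst M N)) ffunE.
    by rewrite (raddfMz (@fst M N)) /= mul0rz.
  rewrite raddfD /= !raddf_sum /= [X in X + _]big1 ?add0r => [|j _].
    by apply: eq_bigr => i _; rewrite (raddfMz (@snd M N)) ffunE.
  by rewrite (raddfMz (@snd M N)) /= mul0rz.
apply: inj_surj_bijective => [f h|[x y]].
  rewrite !E => -[/(can_inj bK)/ffunP fh1 /(can_inj cK)/ffunP fh2].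
  by apply/ffunP => -[i|j]; [have := fh1 i|have := fh2 j]; rewrite !ffunE.
exists [ffun k => match k with inl i => bi x i | inr j => ci y j end].
rewrite E -[in RHS](Kb x) -[in RHS](Kc y).
by congr pair; apply: eq_bigr => i _; rewrite !ffunE.
Qed.

Lemma gact0 (gT : finGroupType) (M : glattice gT) g : gact g (0 : M) = 0.
Proof. exact: (morphD_0 (@gactD _ M g)). Qed.

Lemma is_permutation_gsum (gT : finGroupType) (M N : glattice gT) :
  is_permutation M -> is_permutation N -> is_permutation (gsum M N).
Proof.
move=> [I [b [b_basis b_perm]]] [J [c [c_basis c_perm]]].
exists (I + J)%type, (fun k : I + J =>
    match k with inl i => (b i, 0) | inr j => (0, c j) end : M * N).
split; first exact: is_basis_sum.
move=> g [i|j]; rewrite /= /gsum_act /= gact0.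
  by have [i' ->] := b_perm g i; exists (inl i').
by have [j' ->] := c_perm g j; exists (inr j').
Qed.

(** * Isomorphisms of lattices *)

Section Giso.
Variable gT : finGroupType.
Implicit Types M N L P : glattice gT.

Lemma giso_intro M N (f : M -> N) : {morph f : x y / x + y} ->
  equivariant f -> injective f -> (forall y, exists x, f x = y) -> giso M N.
Proof.
move=> fD f_equiv f_inj f_surj; have [F FE] := additive_of fD.
exists F => [g x|]; first by rewrite !FE f_equiv.
by apply: (eq_bij (inj_surj_bijective f_inj f_surj)) => x; rewrite FE.
Qed.

Lemma giso_refl M : giso M M.
Proof. by exists idfun => //; exists id. Qed.

Lemma giso_sym M N : giso M N -> giso N M.
Proof.
move=> [f f_equiv [g fK gK]]; apply: (@giso_intro _ _ g).
- by move=> x y; apply: (can_inj fK); rewrite raddfD !gK.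
- by move=> s x; apply: (can_inj fK); rewrite f_equiv !gK.
- exact: can_inj gK.
- by move=> x; exists (f x).
Qed.

Lemma giso_trans M N L : giso M N -> giso N L -> giso M L.
Proof.
move=> [f f_equiv f_bij] [h h_equiv h_bij].
exists (h \o f : {additive M -> L}); last exact: bij_comp.
by move=> g x /=; rewrite f_equiv h_equiv.
Qed.

Lemma giso_gsum M M' N N' :
  giso M M' -> giso N N' -> giso (gsum M N) (gsum M' N').
Proof.
move=> [f f_equiv [f' fK f'K]] [h h_equiv [h' hK h'K]].
apply: (@giso_intro (gsum M N) (gsum M' N') (fun x => (f x.1, h x.2))).
- by move=> x y /=; rewrite !raddfD.
- by move=> g x; rewrite /= /gsum_act /= f_equiv h_equiv.
- by move=> [x y] [x' y'] [/(can_inj fK) -> /(can_inj hK) ->].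
- by move=> [x y]; exists (f' x, h' y); rewrite /= f'K h'K.
Qed.

Lemma giso_gsumA M N L : giso (gsum (gsum M N) L) (gsum M (gsum N L)).
Proof.
apply: (@giso_intro (gsum (gsum M N) L) (gsum M (gsum N L))
          (fun x => (x.1.1, (x.1.2, x.2)))) => //.
- by move=> [[x y] z] [[x' y'] z'] [/= -> -> ->].
- by move=> [x [y z]]; exists ((x, y), z).
Qed.

Lemma giso_gsumAC M N L : giso (gsum (gsum M N) L) (gsum (gsum M L) N).
Proof.
apply: (@giso_intro (gsum (gsum M N) L) (gsum (gsum M L) N)
          (fun x => ((x.1.1, x.2), x.1.2))) => //.
- by move=> [[x y] z] [[x' y'] z'] [/= -> -> ->].
- by move=> [[x y] z]; exists ((x, z), y).
Qed.

Lemma giso_gdual M N : giso M N -> giso (gdual M) (gdual N).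
Proof.
move=> /giso_sym[f f_equiv [h fK hK]].
have fD (u : gdual M) : (fun y : N => u (f y)) \in @dual_pred _ N.
  by apply/asboolP => x y; rewrite raddfD dualD.
apply: (@giso_intro (gdual M) (gdual N) (fun u => Dual (fD u) : gdual N)).
- by move=> u v; apply: dual_eqP.
- by move=> g u; apply: dual_eqP => x /=; rewrite f_equiv.
- move=> u v uv; apply: dual_eqP => x.
  by have := congr1 (fun w : gdual N => w (h x)) uv; rewrite /= hK.
- move=> u; have hD : (fun x : M => u (h x)) \in @dual_pred _ M.
    apply/asboolP => x y; rewrite -dualD; congr (u _).
    by apply: (can_inj fK); rewrite raddfD !hK.
  by exists (Dual hD); apply: dual_eqP => y /=; rewrite fK.
Qed.

Lemma giso_gdual_gsum M N : giso (gdual (gsum M N)) (gsum (gdual M) (gdual N)).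
Proof.
have u1D (u : gdual (gsum M N)) :
    (fun x : M => u ((x, 0) : gsum M N)) \in @dual_pred _ M.
  apply/asboolP => x y; rewrite -dualD; congr (u _).
  by apply: injective_projections; rewrite //= addr0.
have u2D (u : gdual (gsum M N)) :
    (fun y : N => u ((0, y) : gsum M N)) \in @dual_pred _ N.
  apply/asboolP => x y; rewrite -dualD; congr (u _).
  by apply: injective_projections; rewrite //= addr0.
apply: (@giso_intro (gdual (gsum M N)) (gsum (gdual M) (gdual N))
          (fun u => (Dual (u1D u), Dual (u2D u)))).
- by move=> u v; apply: injective_projections; apply: dual_eqP.
- move=> g u; apply: injective_projections; apply: dual_eqP => x /=.
    by rewrite /gsum_act /= gact0.
  by rewrite /gsum_act /= gact0.
- move=> u v [uv1 uv2]; apply: dual_eqP => -[x y].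
  have -> : (x, y) = (x, 0) + (0, y) :> gsum M N.
    by apply: injective_projections; rewrite /= ?addr0 ?add0r.
  by rewrite !dualD (congr1 (@^~ x) uv1) (congr1 (@^~ y) uv2).
- move=> [u v].
  have uvD : (fun z : gsum M N => u z.1 + v z.2) \in @dual_pred _ (gsum M N).
    by apply/asboolP => x y; rewrite /= !dualD addrACA.
  exists (Dual uvD); apply: injective_projections; apply: dual_eqP => x /=.
    by rewrite (morphD_0 (dualD v)) addr0.
  by rewrite (morphD_0 (dualD u)) add0r.
Qed.

Lemma giso_gker M N P (f : {additive M -> int}) (h : {additive N -> int})
    (f_inv : forall g x, f (gact g x) = f x)
    (h_inv : forall g x, h (gact g x) = h x)
    (th : {additive M -> gsum N P}) :
  equivariant th -> bijective th -> (forall x, f x = h (th x).1) ->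
  giso (gker f_inv) (gsum (gker h_inv) P).
Proof.
move=> th_equiv [th' thK th'K] fE.
have kerP (x : gker f_inv) : (th (ker_val x)).1 \in ker_pred h.
  by case: x => x /=; rewrite !unfold_in fE.
apply: (@giso_intro _ (gsum (gker h_inv) P)
          (fun x => (Ker (kerP x), (th (ker_val x)).2))).
- move=> x y; apply: injective_projections => /=; last by rewrite raddfD.
  by apply: val_inj; rewrite /= raddfD.
- move=> g x; apply: injective_projections => /=; last by rewrite th_equiv.
  by apply: val_inj; rewrite /= th_equiv.
- move=> x y [xy1 xy2]; apply: val_inj; apply: (can_inj thK).
  exact: injective_projections.
- move=> [[y hy] z].
  have hx : th' (y, z) \in ker_pred f by rewrite unfold_in fE th'K.
  exists (Ker hx); apply: injective_projections; last by rewrite /= th'K.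
  by apply: val_inj; rewrite /= th'K.
Qed.

End Giso.

(** * The lattice Z[G/H] *)

Section Coset.
Variables (gT : finGroupType) (H : {group gT}).

Lemma lcoset_of_subproof (x : gT) : (x *: H)%g \in lcosets H [set: gT].
Proof. by apply/lcosetsP; exists x; rewrite ?inE. Qed.

Definition lcoset_mk (x : gT) : lcoset_of H := Sub (x *: H)%g (lcoset_of_subproof x).

Lemma lcoset_mk_surj (c : lcoset_of H) : exists x, c = lcoset_mk x.
Proof.
case: c => c hc; have /lcosetsP[x _ cE] := hc.
by exists x; apply: val_inj.
Qed.

Lemma lcoset_act_mk g x : lcoset_act g (lcoset_mk x) = lcoset_mk (g * x)%g.
Proof. by apply: val_inj; rewrite /= mulgA mulg_set1. Qed.

Lemma lcoset_mk_eq x y : (lcoset_mk x = lcoset_mk y) <-> (x^-1 * y)%g \in H.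
Proof.
split=> [/(congr1 val)/= xy|xyH]; first by rewrite -mem_lcoset xy lcoset_refl.
by apply: val_inj; apply/esym/lcoset_eqP; rewrite mem_lcoset.
Qed.

Definition zdelta (c : lcoset_of H) : zcoset H :=
  [ffun c' => (c == c')%:R : int].

Lemma zdelta_act g c : gact g (zdelta c) = zdelta (lcoset_act g c).
Proof.
apply/ffunP => c'; rewrite !ffunE; congr ((_ : bool)%:R); apply/eqP/eqP => [->|<-].
  by rewrite -lcoset_actM mulgV lcoset_act1.
by rewrite -lcoset_actM mulVg lcoset_act1.
Qed.

Lemma zdelta_basis : is_basis zdelta.
Proof.
have E (f : {ffun lcoset_of H -> int}) : \sum_c zdelta c *~ f c = f.
  apply/ffunP => c; rewrite sum_ffunE (bigD1 c) //= ffunMzE ffunE eqxx intz.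
  by rewrite big1 ?addr0 // => c' c'c; rewrite ffunMzE ffunE (negbTE c'c) mul0rz.
by exists id.
Qed.

Lemma is_permutation_zcoset : is_permutation (zcoset H).
Proof.
exists (lcoset_of H), zdelta; split; first exact: zdelta_basis.
by move=> g c; exists (lcoset_act g c); rewrite zdelta_act.
Qed.

Lemma giso_gdual_zcoset : giso (gdual (zcoset H)) (zcoset H).
Proof.
apply: (@giso_intro _ (gdual (zcoset H)) (zcoset H)
   (fun u => [ffun c => u (zdelta c)] : zcoset H)).
- by move=> u v; apply/ffunP => c; rewrite !ffunE.
- by move=> g u; apply/ffunP => c; rewrite !ffunE; exact: congr1 (zdelta_act _ _).
- move=> u v /ffunP uv; apply: dual_eqP.
  have [U UE] := additive_of (dualD u); have [V VE] := additive_of (dualD v).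
  move=> x; rewrite -UE -VE; apply: (basis_ext zdelta_basis) => c.
  by have := uv c; rewrite !ffunE UE VE.
- move=> a; have [f fE] := basis_extend (a : lcoset_of H -> int) zdelta_basis.
  have fD : (f : zcoset H -> int) \in @dual_pred _ (zcoset H).
    by apply/asboolP => x y; rewrite raddfD.
  by exists (Dual fD); apply/ffunP => c; rewrite ffunE /= fE.
Qed.

(** Summing over G instead of G/H makes augmentations for different subgroups
    comparable: no fibre of G/K -> G/H has to be counted in [transfer]. *)
Lemma aug_sum_group (a : zcoset H) :
  #|H|%:R * aug a = \sum_(x : gT) (a : {ffun lcoset_of H -> int}) (lcoset_mk x).
Proof.
rewrite (partition_big lcoset_mk xpredT) //= mulr_sumr; apply: eq_bigr => c _.
rewrite (eq_bigr (fun=> (a : {ffun _ -> int}) c)) => [|x /eqP-> //].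
rewrite sumr_const mulr_natl; congr (_ *+ _).
have [y ->] := lcoset_mk_surj c; rewrite -(card_lcoset H y).
apply: eq_card => x; rewrite mem_lcoset.
rewrite -[RHS]/(lcoset_mk x == lcoset_mk y).
by apply/idP/eqP => [/lcoset_mk_eq|/esym/lcoset_mk_eq].
Qed.

(** Frobenius reciprocity: Z[G/H] is also the lattice coinduced from the trivial
    H-lattice Z, so an H-invariant functional l on M is the coefficient at the
    coset H of an equivariant map to Z[G/H]. *)
Lemma frobenius_reciprocity (M : glattice gT) (l : {additive M -> int}) :
  (forall h x, h \in H -> l (gact h x) = l x) ->
  exists2 f : {additive M -> zcoset H}, equivariant f &
    forall x y, (f x : {ffun lcoset_of H -> int}) (lcoset_mk y) = l (gact y^-1%g x).
Proof.
move=> l_inv.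
pose F (x : M) : zcoset H := [ffun c => l (gact (repr (val c))^-1%g x)].
have FE x y : (F x : {ffun lcoset_of H -> int}) (lcoset_mk y) = l (gact y^-1%g x).
  rewrite ffunE /=; have := mem_repr y (lcoset_refl H y).
  set z := repr _ => /lcosetP[h hH ->].
  by rewrite invMg gactM l_inv ?groupV.
have FD : {morph F : x y / x + y}.
  by move=> x y; apply/ffunP => c; rewrite !ffunE gactD raddfD.
have [f fE] := additive_of FD; exists f => [g x|x y]; last by rewrite fE FE.
apply/ffunP => c; have [y ->] := lcoset_mk_surj c.
by rewrite !fE FE ffunE lcoset_act_mk FE invMg invgK gactM.
Qed.

End Coset.

(** The map comes from the functional that reads the coefficient at H: it sends a
    coset of H to the sum of the cosets of K that it contains. *)
Lemma transfer (gT : finGroupType) (H K : {group gT}) : K \subset H ->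
  exists2 t : {additive zcoset H -> zcoset K}, equivariant t &
    forall a, aug (t a) = #|H : K|%g%:R * aug a.
Proof.
move=> KH; pose l (a : zcoset H) : int :=
  (a : {ffun lcoset_of H -> int}) (lcoset_mk H 1%g).
have [L LE] := additive_of (f := l) (fun x y => ffunE _ _).
have lE x a : l (gact x^-1%g a) = (a : {ffun lcoset_of H -> int}) (lcoset_mk H x).
  by rewrite /l ffunE lcoset_act_mk invgK mulg1.
have [|t t_equiv tE] := @frobenius_reciprocity gT K _ L.
  move=> h a hK; rewrite !LE -[h]invgK lE.
  congr ((a : {ffun _ -> int}) _); apply/lcoset_mk_eq.
  by rewrite invgK mulg1 (subsetP KH).
exists t => // a; apply: (@mulfI _ #|K|%:R); first by rewrite pnatr_eq0 -lt0n.
rewrite mulrA -natrM Lagrange // !aug_sum_group.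
by apply: eq_bigr => x _; rewrite tE LE lE.
Qed.

(** * Quasi-permutation and quasi-invertible lattices *)

Section QuasiPermutation.
Variable gT : finGroupType.
Implicit Types M N R F A P : glattice gT.

(** Let tau be an additive section of p and x : R -> A the resulting additive
    retraction of i.  The functional l \o x extends l without being H-invariant.
    Its sum Lam over H is H-invariant but extends |H| * l.  Removing from Lam the
    functional rho \o p, where rho takes at each basis element of F the remainder
    of Lam modulo |H|, makes it divisible by |H| without changing it on A.  Since
    Lam is a multiple of |H| on A, this remainder does not depend on the chosen
    lift of the basis element; hence rho is H-invariant, because H permutes the
    basis. *)
Lemma extend_functional A R F (H : {group gT}) (i : {additive A -> R})
    (p : {additive R -> F}) (l : {additive A -> int}) :
  equivariant i -> equivariant p -> short_exact i p -> is_permutation F ->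
  (forall h x, h \in H -> l (gact h x) = l x) ->
  exists2 L : {additive R -> int},
    forall h x, h \in H -> L (gact h x) = L x & forall x, L (i x) = l x.
Proof.
move=> i_equiv p_equiv [i_inj kerp p_surj] [J [b [b_basis b_perm]]] l_inv.
have actD M g : {morph (gact g : M -> M) : x y / x + y} by exact: gactD.
have [v vE] := choice (fun j => p_surj (b j)).
have [tau tauE] := basis_extend v b_basis.
have tauK y : p (tau y) = y.
  apply: (basis_ext (f := p \o tau) (h := idfun) b_basis) => j /=.
  by rewrite tauE vE.
(* Additivity of x, and x \o i = id, follow from the injectivity of i. *)
have [x xE] : exists x : R -> A, forall r, r = tau (p r) + i (x r).
  suff /choice[x xE] : forall r, exists a, r = tau (p r) + i a by exists x.
  move=> r; have [|a ra] := (kerp (r - tau (p r))).1 _.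
    by rewrite raddfB /= tauK subrr.
  by exists a; rewrite -ra addrC subrK.
have pi a : p (i a) = 0 by apply/kerp; exists a.
have xD : {morph x : r s / r + s}.
  move=> r s; apply: i_inj; apply: (addrI (tau (p (r + s)))).
  by rewrite -xE (raddfD i) (raddfD p) (raddfD tau) addrACA -!xE.
have xi a : x (i a) = a.
  by apply: i_inj; rewrite [in RHS](xE (i a)) pi raddf0 add0r.
pose Lam r := \sum_(h in H) l (x (gact h r)).
have LamD : {morph Lam : r s / r + s}.
  move=> r s; rewrite -big_split /=; apply: eq_bigr => h _.
  by rewrite gactD xD raddfD.
have Lam_i a : Lam (i a) = l a * #|H|%:Z.
  rewrite /Lam (eq_bigr (fun=> l a)) => [|h hH].
    by rewrite sumr_const -mulr_natr natz.
  by rewrite -i_equiv xi l_inv.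
have Lam_inv k r : k \in H -> Lam (gact k r) = Lam r.
  move=> kH; rewrite /Lam [RHS](reindex_inj (mulIg k)) /=.
  by apply: eq_big => h; rewrite ?groupMr // gactM.
have [rho rhoE] := basis_extend (fun j => (Lam (tau (b j)) %% #|H|)%Z) b_basis.
have rho_inv h y : h \in H -> rho (gact h y) = rho y.
  move=> hH; have [ah ahE] := additive_of (actD F h).
  rewrite -ahE; apply: (basis_ext (f := rho \o ah) b_basis) => j /=.
  rewrite ahE; have [j' hj] := b_perm h j; rewrite hj !rhoE.
  have phb : p (gact h (tau (b j))) = b j' by rewrite p_equiv tauK.
  rewrite -(Lam_inv h (tau (b j))) // [in RHS](xE (gact h _)) phb LamD Lam_i.
  by rewrite addrC modzMDl.
have H_neq0 : #|H|%:Z != 0 by rewrite -lt0n cardG_gt0.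
(* By additivity it suffices to test divisibility on A and on lifts of the basis
   of F. *)
have dvdD r : (#|H|%:Z %| Lam r - rho (p r))%Z.
  rewrite {1}(xE r) LamD Lam_i addrAC rpredD ?dvdz_mull //.
  have [D DE] : exists D : {additive F -> int}, forall y, D y = Lam (tau y) - rho y.
    by apply: additive_of => y z; rewrite !raddfD LamD addrACA.
  have [c ->] := basis_span b_basis (p r); rewrite -DE raddf_sum rpred_sum // => j _.
  by rewrite raddfMz rpredMz //= DE rhoE -eqz_mod_dvd modz_mod.
pose Lq r := ((Lam r - rho (p r)) %/ #|H|)%Z.
have LqK r : Lq r * #|H|%:Z = Lam r - rho (p r) by rewrite divzK.
have [|L LE] := additive_of (f := Lq).
  move=> r s; apply: (mulIf H_neq0).
  by rewrite mulrDl !LqK LamD !raddfD addrACA.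
exists L => [h r hH|a]; apply: (mulIf H_neq0); rewrite !LE !LqK.
  by rewrite Lam_inv // p_equiv rho_inv.
by rewrite Lam_i pi raddf0 subr0.
Qed.

(** This is the vanishing of Ext^1(F, Z[G/H]) for a permutation lattice F. *)
Lemma extend_to_zcoset A R F (H : {group gT}) (i : {additive A -> R})
    (p : {additive R -> F}) (f : {additive A -> zcoset H}) :
  equivariant i -> equivariant p -> short_exact i p -> is_permutation F ->
  equivariant f ->
  exists2 e : {additive R -> zcoset H}, equivariant e & forall x, e (i x) = f x.
Proof.
move=> i_equiv p_equiv ip_exact F_perm f_equiv.
have lD : {morph (fun x => (f x : {ffun lcoset_of H -> int}) (lcoset_mk H 1%g))
             : x y / x + y}.
  by move=> x y; rewrite raddfD ffunE.
have [l lE] := additive_of lD.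
have l_act x y : l (gact y^-1%g x) = (f x : {ffun _ -> int}) (lcoset_mk H y).
  by rewrite lE f_equiv ffunE invgK lcoset_act_mk mulg1.
have [|L L_inv Li] := extend_functional i_equiv p_equiv ip_exact F_perm (H := H) (l := l).
  move=> h x hH; rewrite -[h]invgK l_act lE; congr ((f x : {ffun _ -> int}) _).
  by apply/lcoset_mk_eq; rewrite invgK mulg1.
have [e e_equiv eE] := frobenius_reciprocity L_inv; exists e => // x.
apply/ffunP => c; have [y ->] := lcoset_mk_surj c.
by rewrite eE -i_equiv Li l_act.
Qed.

Lemma giso_quasi_permutation M N :
  giso M N -> quasi_permutation N -> quasi_permutation M.
Proof.
move=> [f f_equiv [f' fK f'K]] [R [F [R_perm F_perm [i [p]]]]].
move=> [i_equiv p_equiv [i_inj kerp p_surj]].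
exists R, F; split=> //; exists (i \o f : {additive M -> R}), p; split=> //.
  by move=> g x /=; rewrite f_equiv i_equiv.
split=> //; first by move=> x y /i_inj /(can_inj fK).
move=> y; rewrite kerp; split=> -[x ->]; last by exists (f x).
by exists (f' x); rewrite /= f'K.
Qed.

Lemma quasi_permutation_gsum M P :
  is_permutation P -> quasi_permutation M -> quasi_permutation (gsum M P).
Proof.
move=> P_perm [R [F [R_perm F_perm [i [p]]]]].
move=> [i_equiv p_equiv [i_inj kerp p_surj]].
have [i1 i1E] : exists i1 : {additive gsum M P -> gsum R P},
    forall x, i1 x = (i x.1, x.2).
  by apply: additive_of => x y; rewrite /= raddfD.
exists (gsum R P), F; split=> //; first exact: is_permutation_gsum.
exists i1, (p \o fst : {additive gsum R P -> F}); split.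
- by move=> g x; rewrite !i1E /= /gsum_act /= i_equiv.
- by move=> g x /=; rewrite p_equiv.
split.
- by move=> [x y] [x' y']; rewrite !i1E => -[/= /i_inj -> ->].
- move=> [y z] /=; rewrite kerp; split=> [[x ->]|[[x z'] /=]].
    by exists (x, z); rewrite i1E.
  by rewrite i1E => -[-> _]; exists x.
- by move=> z; have [y yz] := p_surj z; exists (y, 0).
Qed.

(** An extension e : R -> Z[G/H] of the second projection splits Z[G/H] off from
    the cokernel of M in R, so this cokernel is F plus Z[G/H], without forming a
    quotient lattice. *)
Lemma quasi_permutation_cancel M (H : {group gT}) :
  quasi_permutation (gsum M (zcoset H)) -> quasi_permutation M.
Proof.
move=> [R [F [R_perm F_perm [i [p [i_equiv p_equiv ip_exact]]]]]].
have [|e e_equiv eE] := @extend_to_zcoset (gsum M (zcoset H)) _ _ H i p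
   (snd : {additive gsum M (zcoset H) -> zcoset H}) i_equiv p_equiv ip_exact F_perm.
  by [].
have [i_inj kerp p_surj] := ip_exact.
have act_fst g x : gact g ((x, 0) : gsum M (zcoset H)) = (gact g x, 0).
  by apply: injective_projections => //=; exact: (@gact0 _ (zcoset H)).
have [i1 i1E] : exists i1 : {additive M -> R}, forall x, i1 x = i (x, 0).
  apply: additive_of => x y; rewrite -raddfD; congr (i _).
  by apply: injective_projections; rewrite /= ?addr0.
have [p1 p1E] : exists p1 : {additive R -> gsum F (zcoset H)},
    forall r, p1 r = (p r, e r).
  by apply: additive_of => x y; rewrite !raddfD.
exists R, (gsum F (zcoset H)); split=> //.
  by apply: is_permutation_gsum => //; exact: is_permutation_zcoset.
exists i1, p1; split.
- by move=> g x; rewrite !i1E -i_equiv act_fst.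
- by move=> g r; rewrite !p1E p_equiv e_equiv.
split.
- by move=> x y; rewrite !i1E => /i_inj[].
- move=> r; rewrite p1E; split=> [[pr er]|[x ->]].
    have [[x z] rE] := (kerp r).1 pr; exists x.
    by rewrite i1E rE; move: er; rewrite rE eE /= => ->.
  rewrite i1E eE /=; congr pair; by apply/kerp; exists (x, 0).
- move=> [f z]; have [r rf] := p_surj f; exists (r + i (0, z - e r)).
  (* Moving r along the image of Z[G/H] changes e r at will and keeps p r. *)
  have pi0 : p (i (0, z - e r)) = 0 by apply/kerp; exists (0, z - e r).
  by rewrite p1E (raddfD p) (raddfD e) pi0 addr0 rf eE /= addrC subrK.
Qed.

Lemma quasi_permutation_summand M N (H : {group gT}) :
  giso M (gsum N (zcoset H)) -> quasi_permutation M <-> quasi_permutation N.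
Proof.
move=> MN; split=> [Mqp|Nqp].
  exact: (quasi_permutation_cancel (giso_quasi_permutation (giso_sym MN) Mqp)).
apply: (giso_quasi_permutation MN).
by apply: quasi_permutation_gsum => //; exact: is_permutation_zcoset.
Qed.

(** The summand P goes into the complement in one direction, and is added to the
    ambient quasi-permutation lattice in the other. *)
Lemma quasi_invertible_summand M N P :
  is_permutation P -> giso M (gsum N P) ->
  quasi_invertible M <-> quasi_invertible N.
Proof.
move=> P_perm MN; split=> -[Q [L [Qqp QE]]].
  exists Q, (gsum P L); split=> //; apply: giso_trans QE _.
  exact: giso_trans (giso_gsum MN (giso_refl L)) (giso_gsumA N P L).
exists (gsum Q P), L; split; first exact: quasi_permutation_gsum.
apply: giso_trans (giso_gsum QE (giso_refl P)) _.
apply: giso_trans (giso_gsumAC N L P) _.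
exact: giso_gsum (giso_sym MN) (giso_refl L).
Qed.

End QuasiPermutation.

(** * Weighted augmentations *)

Lemma bezout_seq (s : seq nat) : exists u : nat -> int,
  (\big[gcdn/0%N]_(n <- s) n)%:Z = \sum_(j < size s) u j * (nth 0%N s j)%:Z.
Proof.
elim: s => [|n s [u uE]]; first by exists (fun=> 0); rewrite big_nil big_ord0.
have [a [b abE]] := Bezoutz n%:Z (\big[gcdn/0%N]_(n <- s) n)%:Z.
exists (fun j => if j is j'.+1 then b * u j' else a).
rewrite big_cons big_ord_recl -[LHS]abE uE mulr_sumr; congr (_ + _).
by apply: eq_bigr => j _; rewrite lift0 mulrA.
Qed.

Lemma dvdn_biggcd_seq (d : nat) (s : seq nat) :
  (d %| \big[gcdn/0%N]_(n <- s) n)%N = all (dvdn d) s.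
Proof.
by elim: s => [|n s IH]; rewrite ?big_nil ?dvdn0 // big_cons dvdn_gcd IH.
Qed.

Section DirectSum.
Variables (gT : finGroupType) (I : finType) (M : I -> glattice gT).

Lemma gdsum_sumE (J : Type) (s : seq J) (P : pred J) (F : J -> gdsum M) i :
  (\sum_(k <- s | P k) F k) i = \sum_(k <- s | P k) F k i.
Proof. exact: (big_morph (fun x : gdsum M => x i)). Qed.

(** The inclusion of the k-th summand. *)
Definition gdsum_inj k (a : M k) : gdsum M := eqtype.dfwith (fun i => 0 : M i) a.

Lemma gdsum_inj_in k (a : M k) : gdsum_inj a k = a.
Proof. exact: dfwith_in. Qed.

Lemma gdsum_inj_out k (a : M k) i : k != i -> gdsum_inj a i = 0.
Proof. by move=> ki; rewrite /gdsum_inj dfwith_out. Qed.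

Lemma gdsum_injD k : {morph @gdsum_inj k : a b / a + b}.
Proof.
move=> a b; apply: functional_extensionality_dep => i.
have E : (gdsum_inj a + gdsum_inj b) i = gdsum_inj a i + gdsum_inj b i by [].
rewrite E; case: (eqVneq k i) => [<-|ki]; first by rewrite !gdsum_inj_in.
by rewrite !gdsum_inj_out // addr0.
Qed.

Lemma gdsum_inj_act k : equivariant (@gdsum_inj k : M k -> gdsum M).
Proof.
move=> g a; apply: functional_extensionality_dep => i.
have E : gact g (gdsum_inj a) i = gact g (gdsum_inj a i) by [].
rewrite E; case: (eqVneq k i) => [<-|ki]; first by rewrite !gdsum_inj_in.
by rewrite !gdsum_inj_out // gact0.
Qed.

End DirectSum.

Section WeightedAugmentation.
Variables (gT : finGroupType) (calH : {mset {group gT}}) (phi : weight calH).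

Lemma waug_inj (k : copies calH) (a : zcoset (tag k)) :
  waug phi (gdsum_inj (M := fun k : copies calH => zcoset (tag k)) a)
    = (tnth (phi (tag k)) (tagged k))%:Z * aug a.
Proof.
rewrite /waug (bigD1 k) //= gdsum_inj_in big1 ?addr0 // => j jk.
by rewrite gdsum_inj_out 1?eq_sym // (morphD_0 (@augD _ (tag j))) mulr0.
Qed.

(** With wgcd phi K = \sum_j u_j * phi(K)_j and n = q * (H : K) * wgcd phi K, send
    a to q * u_j times its transfer in the j-th copy of Z[G/K]. *)
Lemma lift_augmentation (H K : {group gT}) (n : nat) :
  K \subset H -> (#|H : K|%g * wgcd phi K %| n)%N ->
  exists2 s : {additive zcoset H -> iamb calH}, equivariant s &
    forall a, waug phi (s a) = n%:Z * aug a.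
Proof.
move=> KH /dvdnP[q nE]; have [t t_equiv t_aug] := transfer KH.
have [u uE] := bezout_seq (phi K).
pose k (j : 'I_(calH K)) : copies calH := Tagged (fun K : {group gT} => 'I_(calH K)) j.
pose F (j : 'I_(calH K)) (a : zcoset H) : iamb calH :=
  gdsum_inj (M := fun k : copies calH => zcoset (tag k)) (k := k j)
    (t a *~ (q%:Z * u j)).
have FD j : {morph F j : a b / a + b}.
  by move=> a b; rewrite -gdsum_injD /F raddfD mulrzDl.
have [|s sE] := additive_of (f := fun a => \sum_j F j a).
  by move=> a b; rewrite -big_split; apply: eq_bigr => j _; exact: FD.
exists s => [g a|a].
  have [ag agE] := additive_of (@gactD _ (iamb calH) g).
  rewrite !sE -agE raddf_sum; apply: eq_bigr => j _.
  rewrite agE -gdsum_inj_act; congr gdsum_inj.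
  by rewrite t_equiv; apply/esym/(morphD_Mz (@gactD _ _ g)).
rewrite sE raddf_sum /=.
have E j : waug phi (F j a) =
    u j * (nth 0%N (phi K) j)%:Z * (q%:Z * #|H : K|%g%:Z * aug a).
  rewrite waug_inj /= (tnth_nth 0%N) (morphD_Mz (@augD _ K)) t_aug natz -mulrzr.
  rewrite intz; ring.
rewrite (eq_bigr _ (fun j _ => E j)) -mulr_suml.
have -> : \sum_(j < calH K) u j * (nth 0%N (phi K) j)%:Z = (wgcd phi K)%:Z.
  by rewrite [RHS]uE size_tuple.
rewrite nE !PoszM; ring.
Qed.

End WeightedAugmentation.

(** * Deletion of a weight *)

Section Deletion.
Variables (gT : finGroupType) (calH : {mset {group gT}}) (phi : weight calH).
Variables (H0 : {group gT}) (i0 : 'I_(calH H0)).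
Local Notation calH' := (calH `\ H0)%mset.
Local Notation phi' := (wdel phi i0).

(** The position in phi H of the entry at position j of phi' H. *)
Definition restore_pos (H : {group gT}) (j : nat) : nat :=
  if H == H0 then bump i0 j else j.

Lemma restore_pos_lt (H : {group gT}) (j : 'I_(calH' H)) :
  (restore_pos H j < calH H)%N.
Proof.
rewrite /restore_pos; case: j => j /=; rewrite msetB1E.
case: eqP => [->|_]; last by rewrite subn0.
by rewrite ltn_subRL /bump => jn; case: (i0 <= j)%N; last exact: ltnW.
Qed.

Definition restore (k : copies calH') : copies calH :=
  Tagged (fun H : {group gT} => 'I_(calH H)) (Ordinal (restore_pos_lt (tagged k))).

Definition deleted : copies calH := Tagged (fun H : {group gT} => 'I_(calH H)) i0.

Lemma copies_eq (calK : {mset {group gT}}) (k k' : copies calK) :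
  (k = k') <-> (tag k = tag k' /\ tagged k = tagged k' :> nat).
Proof.
split=> [->//|]; case: k k' => [H j] [H' j'] /= [HH' jj'].
by subst H'; congr existT; apply: val_inj.
Qed.

Lemma restore_inj : injective restore.
Proof.
move=> [H j] [H' j'] /copies_eq[/= HH' jj']; subst H'; apply/copies_eq; split=> //=.
move: jj'; rewrite /restore_pos; case: eqP => // _.
by move=> /(can_inj (bumpK _)).
Qed.

Lemma restore_neq k : restore k != deleted.
Proof.
case: k => [H j]; apply/eqP => /copies_eq[/= HH0]; subst H.
by rewrite /restore_pos eqxx => /esym/eqP; rewrite (negbTE (neq_bump _ _)).
Qed.

Lemma restore_surj k : k != deleted -> exists k', restore k' = k.
Proof.
case: k => [H j]; case: (eqVneq H H0) => [E|HH0 _].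
  subst H => jn; have ji : (j : nat) != i0.
    by apply: contra jn => /eqP ji; apply/eqP/copies_eq.
  have lt : (unbump i0 j < calH' H0)%N.
    rewrite msetB1E eqxx /unbump; have := ltn_ord j; have := ltn_ord i0.
    by case: ltnP; lia.
  exists (Tagged (fun H : {group gT} => 'I_(calH' H)) (Ordinal lt)).
  by apply/copies_eq; rewrite /= /restore_pos eqxx unbumpK // inE.
have lt : (j < calH' H)%N by rewrite msetB1E (negbTE HH0) subn0.
exists (Tagged (fun H : {group gT} => 'I_(calH' H)) (Ordinal lt)).
by apply/copies_eq; rewrite /= /restore_pos (negbTE HH0).
Qed.

Lemma tnth_restore (k : copies calH') :
  tnth (phi (tag (restore k))) (tagged (restore k)) = tnth (phi' (tag k)) (tagged k).
Proof.
case: k => [H j]; rewrite !(tnth_nth 0%N) /= /restore_pos /wdel_seq.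
case: eqP => // E; subst H; rewrite nth_cat size_take size_tuple ltn_ord /bump.
case: ltnP => [ji|ij]; first by rewrite nth_take.
by rewrite nth_drop addSn subnKC.
Qed.

Definition forget_deleted (x : iamb calH) : iamb calH' := fun k => x (restore k).

Lemma waug_restore (x : iamb calH) :
  waug phi x = waug phi' (forget_deleted x)
    + (tnth (phi H0) i0)%:Z * aug (x deleted).
Proof.
rewrite {1}/waug (bigD1 deleted) //= addrC; congr (_ + _).
rewrite (eq_bigl (mem (restore @: [set: copies calH']))) => [|k].
  rewrite big_imset /= => [|? ? _ _ /restore_inj //].
  by apply: eq_big => [k|k _]; rewrite ?inE // tnth_restore.
apply/idP/imsetP => [/restore_surj[k' <-]|[k' _ ->]]; last exact: restore_neq.
by exists k'; rewrite ?inE.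
Qed.

(** The isomorphism of kernels is induced by the shear x |-> (x' + s z, z), where z
    is the component of x at the deleted copy and x' collects the others. *)
Lemma giso_ilat_wdel (s : {additive zcoset H0 -> iamb calH'}) :
  equivariant s ->
  (forall a, waug phi' (s a) = (tnth (phi H0) i0)%:Z * aug a) ->
  giso (ilat phi) (gsum (ilat phi') (zcoset H0)).
Proof.
move=> s_equiv sE.
pose th0 (x : iamb calH) : gsum (iamb calH') (zcoset H0) :=
  (forget_deleted x + s (x deleted), x deleted).
have [|th thE] := additive_of (f := th0).
  move=> x y; apply: injective_projections; last by [].
  rewrite -[RHS]/(forget_deleted x + s (x deleted)
                  + (forget_deleted y + s (y deleted))) /=.
  have -> : forget_deleted (x + y) = forget_deleted x + forget_deleted y by [].
  have -> : (x + y) deleted = x deleted + y deleted by [].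
  by rewrite raddfD addrACA.
apply: (@giso_gker _ (iamb calH) (iamb calH') (zcoset H0) (waug phi) (waug phi') _ _ th).
- move=> g x; rewrite !thE; apply: injective_projections; last by [].
  rewrite [RHS]gactD; congr (_ + _); exact: s_equiv.
- apply: (eq_bij (f := th0)); last by move=> x; rewrite thE.
  apply: inj_surj_bijective => [x y [/[swap] xy0]|[y z]].
    rewrite xy0 => /addIr xy; apply: functional_extensionality_dep => k.
    case: (eqVneq k deleted) => [->//|/restore_surj[k' <-]].
    exact: (congr1 (fun f : iamb calH' => f k') xy).
  pose y' := y - s z.
  pose inj k := @gdsum_inj gT (copies calH) (fun k => zcoset (tag k)) k.
  pose x' : iamb calH := \sum_k' inj (restore k') (y' k').
  pose x : iamb calH := inj deleted z + x'.
  have x0 : x deleted = z.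
    have -> : x deleted = inj deleted z deleted + x' deleted by [].
    rewrite /x' /inj gdsum_inj_in gdsum_sumE big1 ?addr0 // => k _.
    by rewrite gdsum_inj_out // restore_neq.
  have xr k : x (restore k) = y' k.
    have -> : x (restore k) = inj deleted z (restore k) + x' (restore k) by [].
    rewrite /x' /inj gdsum_inj_out 1?eq_sym ?restore_neq // add0r.
    rewrite gdsum_sumE (bigD1 k) //=.
    rewrite gdsum_inj_in big1 ?addr0 // => k' k'k.
    by rewrite gdsum_inj_out // (inj_eq restore_inj).
  exists x; rewrite /th0 x0; congr pair.
  rewrite (_ : forget_deleted x = y') ?subrK //.
  by apply: functional_extensionality_dep => k; rewrite /forget_deleted xr.
- move=> x; rewrite thE; apply: etrans (waug_restore x) _.
  by rewrite -sE; apply/esym/(raddfD (waug phi')).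
Qed.

(** A common divisor of the weights of phi' divides wgcd phi' H, hence the deleted
    weight, hence all the weights of phi. *)
Lemma normalized_wdel (H : {group gT}) :
  (wgcd phi' H %| tnth (phi H0) i0)%N -> normalized phi -> normalized phi'.
Proof.
move=> phi'_dvd phi1; apply/eqP; rewrite -dvdn1 -[X in (_ %| X)%N]phi1.
set d := (X in (X %| _)%N).
have d_dvd (K : {group gT}) : (d %| wgcd phi' K)%N.
  have [K0|Kn] := boolP (K \in calH'); first by apply: (@biggcdn_inf _ K).
  (* The gcd of the empty sequence is 0. *)
  suff -> : wgcd phi' K = 0%N by rewrite dvdn0.
  have /size0nil sz : size (phi' K) = 0%N.
    by rewrite size_tuple; apply/eqP; rewrite -leqn0 leqNgt mset_gt0.
  by rewrite /wgcd sz big_nil.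
apply/dvdn_biggcdP => K _; rewrite dvdn_biggcd_seq; apply/allP => n /tnthP[j ->].
pose k : copies calH := Tagged (fun H : {group gT} => 'I_(calH H)) j.
rewrite -[tnth _ j]/(tnth (phi (tag k)) (tagged k)).
case: (eqVneq k deleted) => [->|/restore_surj[k' <-]].
  exact: dvdn_trans (d_dvd H) phi'_dvd.
rewrite tnth_restore; have := d_dvd (tag k'); rewrite dvdn_biggcd_seq.
by move/allP; apply; exact: mem_tnth.
Qed.

End Deletion.

Local Close Scope ring_scope.

Theorem proposition3p17 (gT : finGroupType) (calH : {mset {group gT}})
    (phi : weight calH) (H0 H0' : {group gT}) (i0 : 'I_(calH H0))
    (H0_in : H0 \in calH) (H0'_in : H0' \in calH)
    (H0'_sub : H0' \subset H0)
    (phi_dvd : #|H0 : H0'|%g * wgcd phi H0' %| tnth (phi H0) i0)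
    (* If H0' = H0 then phi_dvd holds trivially; phi H0 must then satisfy it with
       respect to the entries that remain, or the isomorphisms fail in general. *)
    (phi_dvd_eq : H0' = H0 -> wgcd (wdel phi i0) H0 %| tnth (phi H0) i0) :
  let phi' : weight (calH `\ H0) := wdel phi i0 in
  [/\ normalized phi -> normalized phi',
      giso (ilat phi) (gsum (ilat phi') (zcoset H0)),
      giso (jlat phi) (gsum (jlat phi') (zcoset H0)),
      quasi_permutation (jlat phi) <-> quasi_permutation (jlat phi')
    & quasi_invertible (jlat phi) <-> quasi_invertible (jlat phi')].
Proof.
(* The Bezout relation must use the weights of phi', not those of phi: at H0' these
   differ only if H0' = H0. *)
have phi'_dvd : #|H0 : H0'|%g * wgcd (wdel phi i0) H0' %| tnth (phi H0) i0.
  have [E|neq] := eqVneq H0' H0.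
    by rewrite E indexgg mul1n phi_dvd_eq.
  by move: phi_dvd; rewrite /wgcd /= /wdel_seq (negbTE neq).
have [s s_equiv s_aug] := lift_augmentation H0'_sub phi'_dvd.
have I_iso := giso_ilat_wdel s_equiv s_aug.
have J_iso : giso (jlat phi) (gsum (jlat (wdel phi i0)) (zcoset H0)).
  apply: giso_trans (giso_gdual I_iso) _; apply: giso_trans (giso_gdual_gsum _ _) _.
  exact: giso_gsum (giso_refl _) (giso_gdual_zcoset H0).
split=> //.
- apply: (@normalized_wdel _ _ _ _ _ H0').
  by apply: dvdn_trans phi'_dvd; exact: dvdn_mull.
- exact: quasi_permutation_summand J_iso.
- exact: quasi_invertible_summand (is_permutation_zcoset H0) J_iso.
Qed.
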